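(* Let $X$ and $Y$ be two non-negative random variables with pdfs $f$ and $g$, respectively, let $n$ be a positive integer, and let $\alpha>0$, $\alpha\neq1$. If $X\leq_{hr}Y$, and $X$ or $Y$ is DFR, then $S_{\alpha}(\boldsymbol X_{\rm MRSSU})\leq S_{\alpha}(\boldsymbol Y_{\rm MRSSU})$.
   Context: $X$ and $Y$ are non-negative, absolutely continuous, with pdfs $f,g$, cdfs $F,G$, and hazard rates $\lambda_X=f/\bar F$, $\lambda_Y=g/\bar G$, where $\bar F=1-F$, $\bar G=1-G$. $X\leq_{hr}Y$ (hazard rate order) means $\lambda_X(x)\geq\lambda_Y(x)$ for all $x$. A non-negative random variable is DFR (decreasing failure rate) if its hazard rate is decreasing in $x$. $\boldsymbol X_{\rm MRSSU}$ (maximum ranked set sampling with unequal samples, size $n$) is a vector of $n$ independent random variables whose $i$-th component is the maximum of a simple random sample of size $i$ from $X$. Its Tsallis entropy of order $\alpha>0$, $\alpha\ne1$, is $$S_{\alpha}(\boldsymbol X_{\rm MRSSU})=\frac{1}{1-\alpha}\left(\prod_{i=1}^{n}\left[\int_{0}^{1}i^{\alpha}u^{\alpha(i-1)}f^{\alpha-1}(F^{-1}(u))\,du\right]-1\right),$$ where $f^{\alpha-1}(F^{-1}(u))=[f(F^{-1}(u))]^{\alpha-1}$ and $F^{-1}$ is the right-continuous inverse of $F$; $S_{\alpha}(\boldsymbol Y_{\rm MRSSU})$ is defined in the same way with $g,G$ (same $n$). *)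

(* Defs.v *)
From HB Require Import structures.
From mathcomp Require Import all_boot all_order all_algebra.
From mathcomp Require Import all_classical all_reals all_analysis.

Set Implicit Arguments.
Unset Strict Implicit.
Unset Printing Implicit Defensive.

Import Order.TTheory GRing.Theory Num.Theory.
Import numFieldNormedType.Exports.

Local Open Scope classical_set_scope.
Local Open Scope ring_scope.
Local Open Scope ereal_scope.

(* A pdf is a fixed version, finite and nonnegative everywhere; its existence
   makes the law of X absolutely continuous. *)
Definition is_pdf (d : measure_display) (T : measurableType d) (R : realType)
    (P : probability T R) (X : {RV P >-> R}) (f : R -> R) : Prop :=
  [/\ measurable_fun setT f,
      (forall x, (0 <= f x)%R) &
      forall A : set R, measurable A ->
        distribution P X A = \int[lebesgue_measure]_(x in A) (f x)%:E].

Definition nonnegative_rv (d : measure_display) (T : measurableType d)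
    (R : realType) (P : probability T R) (X : {RV P >-> R}) : Prop :=
  {ae P, forall t, (0 <= X t)%R}.

(* f / (1 - F), with value +oo beyond the right endpoint of the support, where
   1 - F vanishes. *)
Definition hazard_rate (d : measure_display) (T : measurableType d)
    (R : realType) (P : probability T R) (X : {RV P >-> R}) (f : R -> R)
    (x : R) : \bar R :=
  if ccdf X x == 0 then +oo else (f x / fine (ccdf X x))%:E.

Definition hr_le (d1 d2 : measure_display) (T1 : measurableType d1)
    (T2 : measurableType d2) (R : realType)
    (P1 : probability T1 R) (P2 : probability T2 R)
    (X : {RV P1 >-> R}) (f : R -> R) (Y : {RV P2 >-> R}) (g : R -> R) : Prop :=
  forall x : R, hazard_rate Y g x <= hazard_rate X f x.

(* Monotonicity is required on ]0, +oo[: the hazard rate vanishes on the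
   negative half-line, and including 0 would rule out the densities that are
   unbounded near 0 (e.g. Gamma with shape parameter less than 1), since the
   pdf is real-valued. *)
Definition DFR (d : measure_display) (T : measurableType d)
    (R : realType) (P : probability T R) (X : {RV P >-> R})
    (f : R -> R) : Prop :=
  forall x y : R, (0 < x)%R -> (x <= y)%R ->
    hazard_rate X f y <= hazard_rate X f x.

(* Right-continuous inverse of the cdf, meaningful for 0 < u < 1. *)
Definition cdf_inv (d : measure_display) (T : measurableType d)
    (R : realType) (P : probability T R) (X : {RV P >-> R}) (u : R) : R :=
  inf [set x : R | u%:E < cdf X x].

(* [powR] returns 0 on a zero base with a negative exponent; here 0 ^ p = +oo
   for p < 0. *)
Definition epow (R : realType) (a p : R) : \bar R :=
  if (a == 0%R) && (p < 0)%R then +oo else (a `^ p)%:E.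

(* Extended-real valued, since the integrals may be infinite: +oo is possible
   for alpha < 1 and -oo for alpha > 1. *)
Definition tsallis_MRSSU (d : measure_display) (T : measurableType d)
    (R : realType) (P : probability T R) (X : {RV P >-> R}) (f : R -> R)
    (n : nat) (alpha : R) : \bar R :=
  ((1 - alpha)^-1)%:E *
  (\prod_(1 <= i < n.+1)
     \int[lebesgue_measure]_(u in `]0%R, 1%R[)
        ((i%:R `^ alpha * u `^ (alpha * (i.-1)%:R))%:E
         * epow (f (cdf_inv X u)) (alpha - 1))
   - 1).

(* Main.v *)
(* At level [u] the survival functions at the quantiles of [X] and [Y] both equal
   [1 - u], so the densities there are [1 - u] times the hazard rates. The hazard
   rate order makes [X] stochastically smaller, hence its [u]-quantile is the
   smaller one; moving from it to the other quantile decreases the DFR hazard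
   rate, so [g (G^-1 u) <= f (F^-1 u)] for every [u] in ]0, 1[. The integrands,
   hence the products, are then ordered in a sense given by the sign of
   [alpha - 1], which the factor [1 / (1 - alpha)] turns into the stated one. *)

Require Import Defs.
From HB Require Import structures.
From mathcomp Require Import all_boot all_order all_algebra.
From mathcomp Require Import all_classical all_reals all_analysis.
From mathcomp Require Import measurable_realfun lra.

Set Implicit Arguments.
Unset Strict Implicit.
Unset Printing Implicit Defensive.

Import Order.TTheory GRing.Theory Num.Theory.
Import numFieldNormedType.Exports.

Local Open Scope classical_set_scope.
Local Open Scope ring_scope.

(** * Monotonicity of integrals, products and powers *)

Section nonmeasurable_integral.
Local Open Scope ereal_scope.
Context d (T : measurableType d) (R : realType).
Variables (mu : {measure set T -> \bar R}) (D : set T).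

(** The integral of a nonnegative function is a supremum over the simple functions below it, and
    those below [f1] are below [f2]. The entropy integrands can thus be compared without a
    measurability proof for the quantile functions. *)
Lemma ge0_le_integral_nonmeasurable (f1 f2 : T -> \bar R) :
  (forall x, D x -> 0 <= f1 x) -> (forall x, D x -> f1 x <= f2 x) ->
  \int[mu]_(x in D) f1 x <= \int[mu]_(x in D) f2 x.
Proof.
move=> f10 f12.
have f20 x : D x -> 0 <= f2 x.
  by move=> Dx; exact: le_trans (f10 x Dx) (f12 x Dx).
rewrite !ge0_integralE//; apply: ereal_sup_le => _ [h hf <-].
exists h => // x; apply: le_trans (hf x) _; exact: lee_restrict.
Qed.

End nonmeasurable_integral.

Lemma lee_prod_nat (R : realType) (m n : nat) (a b : nat -> \bar R) :
  (forall i, 0 <= a i <= b i)%E ->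
  (\prod_(m <= i < n) a i <= \prod_(m <= i < n) b i)%E.
Proof.
move=> ab.
(* The induction carries nonnegativity along, as multiplying two inequalities requires it. *)
suff /andP[] : (0 <= \prod_(m <= i < n) a i <= \prod_(m <= i < n) b i)%E by [].
elim/big_ind2 : _ => [|x1 x2 y1 y2 /andP[x10 x12] /andP[y10 y12]|//].
  by rewrite lexx lee01.
by rewrite mule_ge0// lee_pmul.
Qed.

Section epow.
Context {R : realType}.
Implicit Types a b p : R.

Lemma epow_ge0 a p : (0 <= epow a p)%E.
Proof. by rewrite /epow; case: ifP => // _; rewrite lee_fin powR_ge0. Qed.

Lemma epow_le_pos a b p : 0 < p -> 0 <= a -> a <= b -> (epow a p <= epow b p)%E.
Proof.
move=> p0 a0 ab; rewrite /epow (ltNge p) (ltW p0) !andbF lee_fin.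
by apply: ge0_ler_powR => //; rewrite ?nnegrE ?(ltW p0) ?(le_trans a0 ab).
Qed.

Lemma epow_le_neg a b p : p < 0 -> 0 <= a -> a <= b -> (epow b p <= epow a p)%E.
Proof.
move=> p0 a0 ab; rewrite /epow p0 !andbT.
(* At [a = 0] the right-hand side is [+oo]; the value 0 of [powR] would break the inequality
   here. *)
have [_|aN0] := eqVneq a 0; first exact: leey.
have a_gt0 : 0 < a by rewrite lt_neqAle eq_sym aN0.
have b_gt0 := lt_le_trans a_gt0 ab.
rewrite gt_eqF// lee_fin -[p]opprK !(powRN _ (- p)).
rewrite lef_pV2 ?posrE ?powR_gt0//.
by apply: ge0_ler_powR => //; rewrite ?nnegrE ?oppr_ge0 ?ltW.
Qed.

End epow.

(** * Cdf and quantiles of a nonnegative variable with a density *)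

Section absolutely_continuous_rv.
Context d (T : measurableType d) (R : realType) (P : probability T R).
Variables (X : {RV P >-> R}) (f : R -> R).
Hypothesis f_pdf : is_pdf X f.

Lemma EFin_fine_cdf x : ((fine (cdf X x))%:E = cdf X x)%E.
Proof. by rewrite fineK// fin_num_measure. Qed.

Lemma fine_cdf_nondecreasing : {homo (fun x => fine (cdf X x)) : x y / x <= y}.
Proof. by move=> x y xy; rewrite fine_le ?fin_num_measure// cdf_nondecreasing. Qed.

Lemma fine_ccdfE x : fine (ccdf X x) = 1 - fine (cdf X x).
Proof. by rewrite ccdf_1_cdf fineB// fin_num_measure. Qed.

Lemma cdf_split x y : x <= y ->
  (cdf X y = cdf X x + distribution P X `]x, y])%E.
Proof.
move=> xy; rewrite /cdf -measureU//=.
  by rewrite -itv_bndbnd_setU.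
rewrite -subset0 => z /=; rewrite !in_itv/= => -[zx /andP[]].
by rewrite ltNge zx.
Qed.

(** Near [x] the cdf is its value at [x - 1] plus the integral of [f] from [x - 1], which is
    continuous in its upper endpoint because [f] is integrable there, with integral at most 1. *)
Lemma fine_cdf_continuous : continuous (fun x => fine (cdf X x)).
Proof.
have [mf f0 Xf] := f_pdf.
move=> x.
have xlt : x - 1 < x + 1 by lra.
have intf : lebesgue_measure.-integrable `[x - 1, x + 1] (EFin \o f).
  apply/integrableP; split.
    by apply/measurable_EFinP; exact: measurable_funS mf.
  under eq_integral do rewrite /= ger0_norm//.
  by rewrite -Xf// (le_lt_trans (probability_le1 _ _))// ltry.
have xin : x \in `]x - 1, x + 1[ by rewrite in_itv/=; lra.
have cx := within_continuous_continuous xlt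
  (parameterized_integral_continuous (ltW xlt) intf) xin.
have eqF : \forall y \near x, fine (cdf X (x - 1)) +
    parameterized_integral lebesgue_measure (x - 1) y f = fine (cdf X y).
  near=> y.
  have xy : x - 1 <= y by apply: ltW; near: y; apply: lt_nbhsr; lra.
  rewrite (cdf_split xy) fineD ?fin_num_measure//; congr (_ + _).
  rewrite /parameterized_integral /Rintegral -integral_itv_obnd_cbnd ?Xf//.
  by apply/measurable_EFinP; exact: measurable_funS mf.
rewrite /continuous_at -(nbhs_singleton eqF).
apply: cvg_trans; first exact: near_eq_cvg eqF.
by apply: cvgD => //; exact: cvg_cst.
Unshelve. all: by end_near. Qed.

Hypothesis X_ge0 : nonnegative_rv X.

(** Almost sure nonnegativity only removes the mass of []-oo, 0[]; the point 0 is null because the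
    law has a density. *)
Lemma cdf_le0 x : x <= 0 -> cdf X x = 0%E.
Proof.
have [mf f0 Xf] := f_pdf.
move=> x0; apply/eqP; rewrite eq_le cdf_ge0 andbT.
apply: le_trans (cdf_nondecreasing X x0) _.
pose O : set R := [set 0].
have XO : distribution P X O = 0%E.
  by rewrite Xf; [exact: integral_set1|exact: measurable_set1].
have -> : cdf X 0 = (distribution P X `]-oo, 0%R[ + distribution P X O)%E.
  rewrite /cdf -measureU//=; first by rewrite setUitv1.
    exact: measurable_set1.
  rewrite -subset0 => z /=; rewrite in_itv/= => -[z0 z_eq0].
  by rewrite z_eq0 ltxx in z0.
rewrite XO adde0.
suff -> : distribution P X `]-oo, 0%R[ = 0%E by [].
have mX : measurable (X @^-1` `]-oo, 0[) by exact: measurable_funPTI.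
apply: (measure_negligible mX).
apply: negligibleS X_ge0 => t /=; rewrite in_itv/= => Xt0.
by apply/negP; rewrite -ltNge.
Qed.

Lemma cdf_gt_neq0 u : u < 1 -> [set x : R | (u%:E < cdf X x)%E] !=set0.
Proof.
rewrite -lte_fin => u1.
have : \forall y \near +oo, (u%:E < cdf X y)%E.
  exact: (cvg_cdfy1 X (open_ereal_gt' u1)).
by move=> /filter_ex[y uFy]; exists y.
Qed.

Lemma cdf_gt_has_lbound u : 0 <= u -> has_lbound [set x : R | (u%:E < cdf X x)%E].
Proof.
move=> u0; exists 0 => x /=; apply: contraTT; rewrite -ltNge => /ltW/cdf_le0 ->.
by rewrite -leNgt lee_fin.
Qed.

Lemma fine_cdf_cdf_inv u : 0 < u < 1 -> fine (cdf X (cdf_inv X u)) = u.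
Proof.
move=> /andP[/ltW/cdf_gt_has_lbound Alb /cdf_gt_neq0 A0].
set A := [set x | _] in Alb A0.
have AF x : A x <-> u < fine (cdf X x).
  by rewrite /A /= -[cdf X x]EFin_fine_cdf lte_fin.
rewrite /cdf_inv -/A; set q := inf A.
have cF := @fine_cdf_continuous q.
apply/eqP; rewrite eq_le; apply/andP; split.
- rewrite leNgt; apply/negP => uFq.
  have near_q : \forall y \near q^'-, u < fine (cdf X y) /\ y < q.
    apply: filterI; last exact: nbhs_left_lt.
    exact: (cvg_at_left_filter cF (lt_nbhsr uFq)).
  have [y [uFy yq]] := @filter_ex _ _ (at_left_proper_filter q) _ near_q.
  by move: yq; rewrite ltNge => /negP; apply; apply: ge_inf => //; apply/AF.
- rewrite leNgt; apply/negP => Fqu.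
  have near_q : \forall y \near q^'+, fine (cdf X y) < u /\ q < y.
    apply: filterI; last exact: nbhs_right_gt.
    exact: (cvg_at_right_filter cF (lt_nbhsl Fqu)).
  have [y [Fyu qy]] := @filter_ex _ _ (at_right_proper_filter q) _ near_q.
  (* Some [z] in [A] lies below [y], so monotonicity puts the cdf at [y] above [u], a
     contradiction. *)
  have /inf_adherent : 0 < y - q by rewrite subr_gt0.
  move=> /(_ A)[]; first by split.
  move=> z /AF uFz; rewrite -/q addrC subrK => /ltW/fine_cdf_nondecreasing.
  by rewrite leNgt (lt_trans Fyu).
Qed.

(** This places the quantiles in the open half-line on which [DFR] asserts monotonicity. *)
Lemma cdf_inv_gt0 u : 0 < u < 1 -> 0 < cdf_inv X u.
Proof.
move=> u01; rewrite ltNge; apply/negP => /cdf_le0 q0.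
have := fine_cdf_cdf_inv u01; rewrite q0/= => u0.
by move: u01; rewrite -u0 ltxx.
Qed.

Lemma hazard_rate_cdf_inv u : 0 < u < 1 ->
  hazard_rate X f (cdf_inv X u) = (f (cdf_inv X u) / (1 - u))%:E.
Proof.
move=> u01; have [_ u1] := andP u01.
have Su : fine (ccdf X (cdf_inv X u)) = 1 - u by rewrite fine_ccdfE fine_cdf_cdf_inv.
rewrite /hazard_rate ifF ?Su//.
by apply/eqP => S0; move: Su; rewrite S0/=; lra.
Qed.

End absolutely_continuous_rv.

(** * Consequences of the hazard rate order for cdfs and quantiles *)

Section hazard_rate_order.
Context d1 d2 (T1 : measurableType d1) (T2 : measurableType d2) (R : realType).
Context (P1 : probability T1 R) (P2 : probability T2 R).
Variables (X : {RV P1 >-> R}) (Y : {RV P2 >-> R}) (f g : R -> R).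
Hypotheses (f_pdf : is_pdf X f) (g_pdf : is_pdf Y g).
Hypotheses (X_ge0 : nonnegative_rv X) (Y_ge0 : nonnegative_rv Y).
Hypothesis X_hr_Y : hr_le X f Y g.

(** The pdf is the hazard rate times the survival function, and neither factor is smaller for [X].
    Strictness keeps the survival function of [X] positive, so its hazard rate is finite, and then
    so is that of [Y]. *)
Lemma hr_le_pdf x : fine (ccdf Y x) < fine (ccdf X x) -> g x <= f x.
Proof.
have [_ g0 _] := g_pdf.
move=> SYX.
have SY0 : 0 <= fine (ccdf Y x) by exact: fine_ge0.
have SX0 : 0 < fine (ccdf X x) by exact: le_lt_trans SYX.
have := X_hr_Y x; rewrite /hazard_rate.
have -> : (ccdf X x == 0%E) = false by apply/eqP => S0; move: SX0; rewrite S0 ltxx.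
case: ifPn => [_|SYN0]; first by rewrite leye_eq.
have {}SY0 : 0 < fine (ccdf Y x).
  rewrite lt_neqAle SY0 andbT eq_sym; apply: contraNneq SYN0 => S0.
  by rewrite -[ccdf Y x]fineK ?fin_num_measure// S0.
rewrite lee_fin ler_pdivrMr// => gf.
apply: le_trans gf _.
have f0 : 0 <= f x by case: f_pdf.
by rewrite mulrAC ler_pdivrMr// ler_wpM2l// ltW.
Qed.

(* Past the last point [a] before [x] where the cdfs are still ordered, the
   survival function of [X] exceeds that of [Y], so the hazard rate order forces
   [g <= f] there, and integrating from [a] to [x] restores the order at [x]. *)
Lemma hr_le_cdf x : fine (cdf Y x) <= fine (cdf X x).
Proof.
rewrite leNgt; apply/negP => XYx.
pose A := [set y | y <= x /\ fine (cdf Y y) <= fine (cdf X y)].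
have A0 : A !=set0.
  (* Both cdfs vanish at nonpositive points. *)
  exists (Num.min 0 x); split; first by rewrite ge_min lexx orbT.
  by rewrite (cdf_le0 f_pdf X_ge0) ?(cdf_le0 g_pdf Y_ge0)// ge_min lexx.
have Aub : has_ubound A by exists x => y [].
pose a := sup A.
(* Continuity of both cdfs makes [A] closed, so it contains its supremum. *)
have [ax YXa] : A a.
  pose D y := fine (cdf X y) - fine (cdf Y y).
  have cB : closed (D @^-1` [set z | 0 <= z]).
    apply: preimage_closed; last exact: closed_ge.
    move=> y _; apply: cvgB; first exact: fine_cdf_continuous f_pdf y.
    exact: fine_cdf_continuous g_pdf y.
  have cA : closed A.
    have := closedI (@closed_le _ x) cB.
    by congr closed; apply/funext => y; rewrite /A /D /= subr_ge0.
  by have := closure_sup A0 Aub; rewrite -((closure_id A).1 cA).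
have gf y : y \in `]a, x] -> g y <= f y.
  rewrite in_itv/= => /andP[ay yx]; apply: hr_le_pdf.
  rewrite !fine_ccdfE ltrD2l ltrN2 ltNge; apply/negP => YXy.
  by have := ub_le_sup Aub (conj yx YXy : A y); rewrite leNgt ay.
have [mf f0 Xf] := f_pdf; have [mg g0 Yg] := g_pdf.
have : (distribution P2 Y `]a, x] <= distribution P1 X `]a, x])%E.
  rewrite Xf// Yg//; apply: ge0_le_integral_nonmeasurable => y axy.
    by rewrite lee_fin.
  by rewrite lee_fin gf.
move: XYx; rewrite (cdf_split X ax) (cdf_split Y ax).
rewrite !fineD ?fin_num_measure// => XYx.
move=> /fine_le; rewrite ?fin_num_measure// => /(_ isT isT) YXax.
by move: XYx; apply/negP; rewrite -leNgt lerD.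
Qed.

(** The cdf of [X] dominates, so it exceeds [u] wherever that of [Y] does. *)
Lemma hr_le_cdf_inv u : 0 < u < 1 -> cdf_inv X u <= cdf_inv Y u.
Proof.
move=> /andP[/ltW u0 u1]; apply: lb_le_inf; first exact: cdf_gt_neq0.
move=> y /= uFy; apply: ge_inf; first exact: cdf_gt_has_lbound f_pdf X_ge0 _ u0.
apply: lt_le_trans uFy _.
by rewrite -(EFin_fine_cdf Y) -(EFin_fine_cdf X) lee_fin hr_le_cdf.
Qed.

Lemma hr_le_DFR_quantile_pdf u : DFR X f \/ DFR Y g -> 0 < u < 1 ->
  g (cdf_inv Y u) <= f (cdf_inv X u).
Proof.
move=> XY_DFR u01; have [_ u1] := andP u01.
have qX0 := cdf_inv_gt0 f_pdf X_ge0 u01.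
have qXY := hr_le_cdf_inv u01.
have : (hazard_rate Y g (cdf_inv Y u) <= hazard_rate X f (cdf_inv X u))%E.
  (* If [X] is DFR, the hazard rates are compared at the quantile of [Y]; if [Y] is DFR, at the
     quantile of [X]. *)
  case: XY_DFR => dfr.
    exact: le_trans (X_hr_Y _) (dfr _ _ qX0 qXY).
  exact: le_trans (dfr _ _ qX0 qXY) (X_hr_Y _).
rewrite (hazard_rate_cdf_inv f_pdf X_ge0 u01) (hazard_rate_cdf_inv g_pdf Y_ge0 u01).
by rewrite lee_fin ler_pM2r// invr_gt0 subr_gt0.
Qed.

End hazard_rate_order.

Theorem theorem2p3 (R : realType)
    (d1 d2 : measure_display) (T1 : measurableType d1) (T2 : measurableType d2)
    (P1 : probability T1 R) (P2 : probability T2 R)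
    (X : {RV P1 >-> R}) (Y : {RV P2 >-> R}) (f g : R -> R)
    (n : nat) (alpha : R)
    (X_ge0 : nonnegative_rv X) (Y_ge0 : nonnegative_rv Y)
    (f_pdf : is_pdf X f) (g_pdf : is_pdf Y g)
    (n_gt0 : (0 < n)%N) (alpha_gt0 : (0 < alpha)%R) (alpha_neq1 : alpha <> 1%R)
    (X_hr_Y : hr_le X f Y g) (XY_DFR : DFR X f \/ DFR Y g) :
  (tsallis_MRSSU X f n alpha <= tsallis_MRSSU Y g n alpha)%E.
Proof.
have gf u : `]0, 1[%classic u -> g (cdf_inv Y u) <= f (cdf_inv X u).
  by rewrite /= in_itv/=; exact: hr_le_DFR_quantile_pdf.
have f0 x : 0 <= f x by case: f_pdf.
have g0 x : 0 <= g x by case: g_pdf.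
(* Kept general in [a] and [b], since the two densities swap roles with the sign of [alpha - 1]. *)
have prod_le (a b : R -> \bar R) :
    (forall u : R, `]0, 1[%classic u -> (0 <= a u <= b u)%E) ->
    (\prod_(1 <= i < n.+1) \int[lebesgue_measure]_(u in `]0%R, 1%R[)
        ((i%:R `^ alpha * u `^ (alpha * (i.-1)%:R))%:E * a u) <=
     \prod_(1 <= i < n.+1) \int[lebesgue_measure]_(u in `]0%R, 1%R[)
        ((i%:R `^ alpha * u `^ (alpha * (i.-1)%:R))%:E * b u))%E.
  move=> ab; apply: lee_prod_nat => i.
  have w0 u : (0 <= (i%:R `^ alpha * u `^ (alpha * (i.-1)%:R))%:E)%E.
    by rewrite lee_fin mulr_ge0// powR_ge0.
  rewrite integral_ge0/=; last by move=> u /ab/andP[a0 _]; exact: mule_ge0.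
  apply: ge0_le_integral_nonmeasurable => u /ab/andP[a0 aleb].
    exact: mule_ge0.
  exact: lee_wpmul2l.
have [alpha_gt1|alpha_lt1|alpha_eq1] := ltgtP 1 alpha;
  last (by case: alpha_neq1); rewrite /tsallis_MRSSU.
- set pX := (X in (X - 1)%E); set pY := (X in (_ <= _ * (X - 1))%E).
  have pYX : (pY <= pX)%E.
    apply: prod_le => u /gf gfu; apply/andP; split; first exact: epow_ge0.
    by apply: epow_le_pos => //; rewrite subr_gt0.
  (* The factor [(1 - alpha)^-1] is negative, so both sides are negated to multiply by a nonnegative
     constant. *)
  move: pX pY pYX => pX pY pYX; rewrite -leeN2 -!mulNe; apply: lee_wpmul2l.
    by rewrite -EFinN lee_fin oppr_ge0 invr_le0 subr_le0 ltW.
  exact: leeB.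
- apply: lee_wpmul2l; first by rewrite lee_fin invr_ge0 subr_ge0 ltW.
  apply: leeB; last exact: lexx.
  apply: prod_le => u /gf gfu; apply/andP; split; first exact: epow_ge0.
  by apply: epow_le_neg => //; rewrite subr_lt0.
Qed.
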